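(* Let $\mathcal{H}$ be a complex Hilbert space of finite dimension $d$, let $\mathcal{N}:\mathcal{L}(\mathcal{H})\to\mathcal{L}(\mathcal{H})$ be any quantum-classical-quantum (QCQ) noise, and let $\{|\phi_\omega\rangle\}_{\omega=1,\dots,d}$ be an arbitrary orthonormal basis of $\mathcal{H}$. Then, among all ex-ante-ex-post control protocols, $\mathcal{N}$ is optimally suppressed by the ``discriminate and reprepare'' protocol $\{(\mathcal{I}_\omega,\mathcal{C}_\omega)\}_{\omega=1,\dots,d}$ defined by $$\mathcal{I}_\omega(\rho)=|\phi_\omega\rangle\langle\phi_\omega|\,\rho\,|\phi_\omega\rangle\langle\phi_\omega|,\qquad \mathcal{C}_\omega(\rho)=|\phi_\omega\rangle\langle\phi_\omega|\operatorname{Tr}\rho ,$$ and the optimal average fidelity is $\bar F_{\mathrm{DR}}=\dfrac{2}{d+1}$.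
   Context: $\mathcal{L}(\mathcal{H})$ is the space of linear operators on the finite-dimensional complex Hilbert space $\mathcal{H}$. TPCP means trace-preserving and completely positive. A noise process is a TPCP map $\mathcal{N}:\mathcal{L}(\mathcal{H})\to\mathcal{L}(\mathcal{H})$. A map $\mathcal{F}$ on $\mathcal{L}(\mathcal{H})$ is a QCQ channel (QCQ noise) if it has the form $\mathcal{F}(\rho)=\sum_k\rho_k\operatorname{Tr}(M_k\rho)$, a finite sum, where each $\rho_k$ is a density operator on $\mathcal{H}$ ($\rho_k\ge0$, $\operatorname{Tr}\rho_k=1$) and $\{M_k\}$ is a POVM on $\mathcal{H}$ ($M_k\ge0$, $\sum_kM_k=1$). An ex-ante-ex-post control protocol is a family $\{(\mathcal{I}_\omega,\mathcal{C}_\omega)\}_{\omega\in\Omega}$ indexed by a finite set $\Omega$ (arbitrary, depending on the protocol), where each $\mathcal{I}_\omega:\mathcal{L}(\mathcal{H})\to\mathcal{L}(\mathcal{H})$ is completely positive, $\sum_{\omega\in\Omega}\mathcal{I}_\omega$ is trace-preserving (i.e. $\{\mathcal{I}_\omega\}$ is a CP instrument), and each $\mathcal{C}_\omega:\mathcal{L}(\mathcal{H})\to\mathcal{L}(\mathcal{H})$ is TPCP. The average operation of the protocol for noise $\mathcal{N}$ is $\mathcal{E}=\sum_{\omega\in\Omega}\mathcal{C}_\omega\circ\mathcal{N}\circ\mathcal{I}_\omega$, and its average fidelity is $$\bar F=\int_{\|\psi\|=1}\langle\psi|\,\mathcal{E}(|\psi\rangle\langle\psi|)\,|\psi\rangle\,d\psi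 ,$$ where $d\psi$ is the normalized uniform (unitarily invariant) probability measure on the unit sphere of $\mathcal{H}$. A protocol optimally suppresses $\mathcal{N}$ (is optimal for $\mathcal{N}$) if its average fidelity for $\mathcal{N}$ is greater than or equal to that of every ex-ante-ex-post control protocol; the optimal average fidelity is this maximal value. *)

(* Defs.v *)
From HB Require Import structures.
From mathcomp Require Import all_boot all_order all_algebra.
From mathcomp Require Import all_classical all_reals all_analysis.
From mathcomp Require Import complex.

Set Implicit Arguments.
Unset Strict Implicit.
Unset Printing Implicit Defensive.

Import Order.TTheory GRing.Theory Num.Theory.
Import numFieldNormedType.Exports.

Local Open Scope ring_scope.
Local Open Scope complex_scope.
Local Open Scope sesquilinear_scope.
Local Open Scope classical_set_scope.

(* A d-dimensional complex Hilbert space is C^d with its standard inner product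
   (kets are column vectors), where C = R[i]; L(H) is 'M[R[i]]_d. *)

Definition braket (R : realType) (d : nat) (phi psi : 'cV[R[i]]_d) : R[i] :=
  (phi ^t* *m psi) ord0 ord0.

Definition ketbra (R : realType) (d : nat) (psi : 'cV[R[i]]_d) : 'M[R[i]]_d :=
  psi *m psi ^t*.

(* In the partial order of R[i], 0 <= z means that z is real and nonnegative;
   hence [psd A] entails that A is Hermitian. *)
Definition psd (R : realType) (d : nat) (A : 'M[R[i]]_d) : Prop :=
  forall x : 'cV[R[i]]_d, 0 <= braket x (A *m x).

Definition density (R : realType) (d : nat) (rho : 'M[R[i]]_d) : Prop :=
  psd rho /\ \tr rho = 1.

Definition povm (R : realType) (d n : nat) (M : 'I_n -> 'M[R[i]]_d) : Prop :=
  (forall k, psd (M k)) /\ \sum_k M k = 1%:M.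

Definition trace_preserving (R : realType) (d : nat)
    (F : 'M[R[i]]_d -> 'M[R[i]]_d) : Prop :=
  linear F /\ forall rho, \tr (F rho) = \tr rho.

(* id_k (x) F, where L(C^k (x) C^d) is viewed as the k x k block matrices
   with blocks in L(C^d). *)
Definition ampliation (R : realType) (d k : nat)
    (F : 'M[R[i]]_d -> 'M[R[i]]_d)
    (X : 'M[R[i]]_(\sum_(i < k) d)) : 'M[R[i]]_(\sum_(i < k) d) :=
  \mxblock_(i < k, j < k) F (submxblock X i j).

Definition completely_positive (R : realType) (d : nat)
    (F : 'M[R[i]]_d -> 'M[R[i]]_d) : Prop :=
  linear F /\
  forall (k : nat) (X : 'M[R[i]]_(\sum_(i < k) d)), psd X -> psd (ampliation F X).

Definition tpcp (R : realType) (d : nat)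
    (F : 'M[R[i]]_d -> 'M[R[i]]_d) : Prop :=
  trace_preserving F /\ completely_positive F.

Definition qcq (R : realType) (d : nat)
    (F : 'M[R[i]]_d -> 'M[R[i]]_d) : Prop :=
  exists (n : nat) (sigma M : 'I_n -> 'M[R[i]]_d),
    [/\ forall k, density (sigma k), povm M
      & forall rho, F rho = \sum_k \tr (M k *m rho) *: sigma k].

Definition control_protocol (R : realType) (d : nat) (Omega : finType)
    (I C : Omega -> 'M[R[i]]_d -> 'M[R[i]]_d) : Prop :=
  [/\ forall w, completely_positive (I w),
      trace_preserving (fun rho => \sum_w I w rho)
    & forall w, tpcp (C w)].

Definition average_operation (R : realType) (d : nat) (Omega : finType)
    (N : 'M[R[i]]_d -> 'M[R[i]]_d) (I C : Omega -> 'M[R[i]]_d -> 'M[R[i]]_d)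
    (rho : 'M[R[i]]_d) : 'M[R[i]]_d :=
  \sum_w C w (N (I w rho)).

(* C^d with its Borel sigma-algebra.  The cast to numFieldType gives access to
   the norm topology of R[i], which is not canonical on R[i] itself. *)
Definition borel_display (R : realType) (d : nat) : measure_display :=
  sigma_display (@open 'cV[(R[i] : numFieldType)]_d).

Definition borel_cV (R : realType) (d : nat)
    : measurableType (borel_display R d) :=
  g_sigma_algebraType (@open 'cV[(R[i] : numFieldType)]_d).

Definition unit_sphere (R : realType) (d : nat) : set (borel_cV R d) :=
  [set psi : 'cV[R[i]]_d | braket psi psi = 1].

(* The normalized uniform measure on the unit sphere, as a Borel probability
   measure on C^d carried by the sphere; unitary invariance determines it
   uniquely. *)
Definition uniform_on_sphere (R : realType) (d : nat)
    (mu : probability (borel_cV R d) R) : Prop :=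
  mu (@unit_sphere R d) = 1%E /\
  forall U : 'M[R[i]]_d, U \is unitarymx ->
  forall A : set (borel_cV R d), measurable A ->
    mu ((fun psi : 'cV[R[i]]_d => U *m psi) @^-1` A) = mu A.

(* <psi|E(|psi><psi|)|psi> is real for a completely positive E, so taking its
   real part only changes its type. *)
Definition average_fidelity (R : realType) (d : nat)
    (mu : probability (borel_cV R d) R) (Omega : finType)
    (N : 'M[R[i]]_d -> 'M[R[i]]_d) (I C : Omega -> 'M[R[i]]_d -> 'M[R[i]]_d)
    : R :=
  \int[mu]_(psi in @unit_sphere R d)
    complex.Re (braket psi (average_operation N I C (ketbra psi) *m psi)).

Definition optimal_protocol (R : realType) (d : nat)
    (mu : probability (borel_cV R d) R) (Omega : finType)
    (N : 'M[R[i]]_d -> 'M[R[i]]_d) (I C : Omega -> 'M[R[i]]_d -> 'M[R[i]]_d)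
    : Prop :=
  control_protocol I C /\
  forall (Omega' : finType) (I' C' : Omega' -> 'M[R[i]]_d -> 'M[R[i]]_d),
    control_protocol I' C' ->
    average_fidelity mu N I' C' <= average_fidelity mu N I C.

(* d orthonormal vectors of C^d automatically span it. *)
Definition orthonormal_basis (R : realType) (d : nat)
    (phi : 'I_d -> 'cV[R[i]]_d) : Prop :=
  forall i j, braket (phi i) (phi j) = (i == j)%:R.

Definition dr_instrument (R : realType) (d : nat)
    (phi : 'I_d -> 'cV[R[i]]_d) (w : 'I_d) (rho : 'M[R[i]]_d) : 'M[R[i]]_d :=
  ketbra (phi w) *m rho *m ketbra (phi w).

Definition dr_control (R : realType) (d : nat)
    (phi : 'I_d -> 'cV[R[i]]_d) (w : 'I_d) (rho : 'M[R[i]]_d) : 'M[R[i]]_d :=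
  \tr rho *: ketbra (phi w).

(* Main.v *)
(* For a unit vector u, J(u) = \int |<u|psi>|^4 does not depend on u, by unitary
   invariance.  Averaging |<u|psi>|^4 over u = (3/5) e_i + (4/5) w e_j, with w
   a fourth root of unity, gives \int |psi_i|^2 |psi_j|^2 = J/2 for i <> j;
   integrating (\sum_i |psi_i|^2)^2 = 1 then yields J = 2 / (d (d + 1)).

   For a QCQ noise the average operation is again of the measure-and-prepare
   form rho |-> \sum_p Tr(E_p rho) tau_p, where the effects E_p are positive with
   \sum_p Tr E_p = d and the tau_p are density operators.  Diagonalizing E_p and
   tau_p reduces \int <psi|E_p|psi> <psi|tau_p|psi> to integrals of
   |<u|psi>|^2 |<v|psi>|^2, which are at most J by the arithmetic-geometric mean
   inequality; so the fidelity is at most d J = 2 / (d + 1).  Discriminate and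
   reprepare has integrand \sum_w |<phi_w|psi>|^4 and attains this bound. *)
Require Import Defs.
From HB Require Import structures.
From mathcomp Require Import all_boot all_order all_algebra.
From mathcomp Require Import all_classical all_reals all_analysis.
From mathcomp Require Import complex measurable_realfun ring lra.

Set Implicit Arguments.
Unset Strict Implicit.
Unset Printing Implicit Defensive.

Import Order.TTheory GRing.Theory Num.Theory.
Import numFieldNormedType.Exports.
Local Open Scope ring_scope.
Local Open Scope complex_scope.
Local Open Scope sesquilinear_scope.
Local Open Scope classical_set_scope.

(** * Positive operators and channels *)

Section Operators.
Context (R : realType).

Lemma braketE d (x y : 'cV[R[i]]_d) :
  braket x y = \sum_j (x j ord0)^* * y j ord0.
Proof. by rewrite /braket !mxE; apply: eq_bigr => j _; rewrite !mxE. Qed.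

Lemma braket_conj d (x y : 'cV[R[i]]_d) : braket y x = (braket x y)^*.
Proof.
rewrite !braketE rmorph_sum; apply: eq_bigr => j _.
by rewrite rmorphM /= conjcK mulrC.
Qed.

Lemma braketDr d (x y z : 'cV[R[i]]_d) :
  braket x (y + z) = braket x y + braket x z.
Proof. by rewrite /braket mulmxDr mxE. Qed.

Lemma braketZr d (x y : 'cV[R[i]]_d) c : braket x (c *: y) = c * braket x y.
Proof. by rewrite /braket -scalemxAr mxE. Qed.

Lemma braketDl d (x y z : 'cV[R[i]]_d) :
  braket (x + y) z = braket x z + braket y z.
Proof. by rewrite braket_conj braketDr rmorphD /= -!braket_conj. Qed.

Lemma braketZl d (x y : 'cV[R[i]]_d) c :
  braket (c *: x) y = c^* * braket x y.
Proof. by rewrite braket_conj braketZr rmorphM /= -braket_conj. Qed.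

Lemma braketBr d (x y z : 'cV[R[i]]_d) :
  braket x (y - z) = braket x y - braket x z.
Proof. by rewrite braketDr -scaleN1r braketZr mulN1r. Qed.

Lemma braketBl d (x y z : 'cV[R[i]]_d) :
  braket (x - y) z = braket x z - braket y z.
Proof. by rewrite braket_conj braketBr rmorphB /= -!braket_conj. Qed.

Lemma braket_suml d (I : finType) (x : I -> 'cV[R[i]]_d) y :
  braket (\sum_i x i) y = \sum_i braket (x i) y.
Proof.
rewrite braketE; under [RHS]eq_bigr do rewrite braketE.
rewrite exchange_big /=; apply: eq_bigr => j _.
by rewrite summxE rmorph_sum mulr_suml.
Qed.

Lemma braket_sumr d (I : finType) (x : I -> 'cV[R[i]]_d) y :
  braket y (\sum_i x i) = \sum_i braket y (x i).
Proof.
rewrite braket_conj braket_suml rmorph_sum.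
by apply: eq_bigr => i _; rewrite [RHS]braket_conj.
Qed.

Lemma braket_ge0 d (x : 'cV[R[i]]_d) : 0 <= braket x x.
Proof.
by rewrite braketE; apply: sumr_ge0 => j _; rewrite mulrC; exact: mulcJ_ge0.
Qed.

Lemma braket_eq0 d (x : 'cV[R[i]]_d) : braket x x = 0 -> x = 0.
Proof.
rewrite braketE => /eqP; rewrite psumr_eq0 => [/allP x0|j _]; last first.
  by rewrite mulrC; exact: mulcJ_ge0.
apply/colP => j; rewrite mxE; have /= := x0 j (mem_index_enum _).
by rewrite mulf_eq0 conjc_eq0 orbb => /eqP.
Qed.

Lemma adjmx_mul m n p (A : 'M[R[i]]_(m, n)) (B : 'M[R[i]]_(n, p)) :
  (A *m B) ^t* = B ^t* *m A ^t*.
Proof. by rewrite trmx_mul map_mxM. Qed.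

Lemma adjmxB m n (A B : 'M[R[i]]_(m, n)) : (A - B) ^t* = A ^t* - B ^t*.
Proof. by apply/matrixP => i j; rewrite !mxE rmorphB. Qed.

Lemma adjmxZ m n c (A : 'M[R[i]]_(m, n)) : (c *: A) ^t* = c^* *: A ^t*.
Proof. by apply/matrixP => i j; rewrite !mxE rmorphM. Qed.

Lemma braket_adjmx d (A : 'M[R[i]]_d) (x y : 'cV[R[i]]_d) :
  braket x (A *m y) = braket (A ^t* *m x) y.
Proof. by rewrite /braket adjmx_mul trmxCK mulmxA. Qed.

Definition ket d (i : 'I_d) : 'cV[R[i]]_d := delta_mx i ord0.

Lemma braket_ket d (i : 'I_d) (x : 'cV[R[i]]_d) : braket (ket i) x = x i ord0.
Proof.
rewrite braketE (bigD1 i) //= big1 ?addr0 => [|j /negbTE ji].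
  by rewrite !mxE !eqxx conjC1 mul1r.
by rewrite mxE ji conjC0 mul0r.
Qed.

Lemma mul_ket d (A : 'M[R[i]]_d) i j : (A *m ket j) i ord0 = A i j.
Proof. by rewrite -colE mxE. Qed.

Lemma ketbraM d (x y : 'cV[R[i]]_d) : ketbra x *m y = braket x y *: x.
Proof.
rewrite /ketbra /braket -mulmxA [x ^t* *m y]mx11_scalar mul_mx_scalar.
by congr (_ *: _); rewrite [RHS]mxE eqxx mulr1n.
Qed.

Lemma mxtrace_ketbra d (x : 'cV[R[i]]_d) : \tr (ketbra x) = braket x x.
Proof. by rewrite /ketbra mxtrace_mulC trace_mx11. Qed.

Lemma mxtraceM_ketbra d (A : 'M[R[i]]_d) (x : 'cV[R[i]]_d) :
  \tr (A *m ketbra x) = braket x (A *m x).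
Proof. by rewrite /ketbra mulmxA mxtrace_mulC trace_mx11. Qed.

Lemma psd_ketbra d (x : 'cV[R[i]]_d) : psd (ketbra x).
Proof.
move=> y; rewrite ketbraM braketZr braket_conj.
by rewrite mulrC; exact: mulcJ_ge0.
Qed.

(** Polarization: the form is real on [ket i + c *: ket j]. Taking [c = 1] matches the imaginary
    parts of the two off-diagonal entries, and [c = 'i] their real parts. *)
Lemma psd_hermitian d (A : 'M[R[i]]_d) : psd A -> A ^t* = A.
Proof.
move=> Apsd; apply/matrixP => i j; rewrite !mxE.
have q c : complex.Im (A i i + c * A i j + (c^* * A j i + c^* * (c * A j j))) = 0.
  have /ger0_Im <- := Apsd (ket i + c *: ket j).
  congr complex.Im; rewrite mulmxDr -scalemxAr !braketDl !braketDr !braketZl.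
  by rewrite !braketZr !braket_ket !mul_ket.
have q0 k : complex.Im (A k k) = 0.
  by have /ger0_Im := Apsd (ket k); rewrite braket_ket mul_ket.
have := q 1; have := q 'i; have := q0 i; have := q0 j.
case: (A i i) (A j j) (A i j) (A j i) => [a a'] [b b'] [c c'] [e e'].
rewrite /= => -> ->; simpc.
by move=> /subr0_eq -> /eqP; rewrite addr_eq0 => /eqP ->.
Qed.

(** A Hermitian matrix is normal, so the spectral theorem applies. Each eigenvalue is the value of
    the form at its own eigenvector, hence real and nonnegative. *)
Lemma psd_spectral d (A : 'M[R[i]]_d) : psd A ->
  exists (a : 'I_d -> R) (u : 'I_d -> 'cV[R[i]]_d),
    [/\ forall i, 0 <= a i, forall i, braket (u i) (u i) = 1
      & A = \sum_i (a i)%:C *: ketbra (u i)].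
Proof.
move=> Apsd; have /orthomx_spectralP : A \is normalmx.
  by apply/normalmxP; rewrite psd_hermitian.
set P := spectralmx A; set s := spectral_diag A.
have PU : P \is unitarymx := spectral_unitarymx A.
rewrite invmx_unitary // => AE.
pose u i := P ^t* *m ket i.
have uu i j : braket (u i) (u j) = (i == j)%:R.
  rewrite -[u i]/(P ^t* *m ket i) -braket_adjmx mulmxA (unitarymxP PU).
  by rewrite mul1mx braket_ket mxE eqxx andbT.
have A_sum : A = \sum_i s ord0 i *: ketbra (u i).
  rewrite {1}AE mul_mx_diag; apply/matrixP => j k; rewrite summxE [LHS]mxE.
  apply: eq_bigr => i _; rewrite [RHS]mxE /ketbra [in RHS]mxE big_ord1.
  rewrite [in LHS]mxE.
  rewrite [(u i ^t*) ord0 k]mxE [(u i)^T _ _]mxE !mul_ket.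
  by rewrite [(P ^t*) k i]mxE [P^T k i]mxE conjCK mulrA [s _ _ * _]mulrC.
have s_E i : s ord0 i = braket (u i) (A *m u i).
  rewrite A_sum mulmx_suml braket_sumr (bigD1 i) //= big1 => [|j ji].
    by rewrite -scalemxAl ketbraM uu eqxx scale1r braketZr uu eqxx mulr1 addr0.
  rewrite -scalemxAl ketbraM uu (negbTE ji) scale0r scaler0.
  by rewrite -[0](scale0r 0) braketZr mul0r.
have s_ge0 i : 0 <= s ord0 i by rewrite s_E.
exists (fun i => complex.Re (s ord0 i)), u; split=> [i|i|].
- by rewrite -ler0c RRe_real // ger0_real.
- by rewrite uu eqxx.
- by rewrite A_sum; apply: eq_bigr => i _; rewrite RRe_real // ger0_real.
Qed.

(* With [w = u - v], the unitary is [1 - |w><w| / <w|u>]: a reflection when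
   [<v|u>] is real, and unitary in general because [<w|u> + <u|w> = <w|w>]. *)
Lemma unitary_transport d (u v : 'cV[R[i]]_d) :
  braket u u = 1 -> braket v v = 1 ->
  exists2 U : 'M[R[i]]_d, U \is unitarymx & U *m u = v.
Proof.
move=> u1 v1; have [uv|uv] := eqVneq u v.
  by exists 1%:M; rewrite ?mul1mx // qualifE /= mul1mx trmx1 map_mx1.
(* [a] is the overlap of [w] with [u]; if it vanished, [a_sum] would force [w = 0]. *)
pose w := u - v; pose a := 1 - braket v u.
have a_sum : a + a^* = braket w w.
  rewrite /a /w rmorphB rmorph1 braketBl !braketBr u1 v1 (braket_conj v u).
  ring.
have a0 : a != 0.
  apply: contra_neq uv => a0; apply/eqP; rewrite -subr_eq0; apply/eqP.
  by apply: braket_eq0; rewrite -/w -a_sum a0 conjC0 addr0.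
exists (1%:M - a^-1 *: ketbra w).
  apply/unitarymxP; rewrite adjmxB adjmxZ trmx1 map_mx1.
  rewrite (psd_hermitian (@psd_ketbra _ w)).
  rewrite mulmxBl mul1mx mulmxBr mulmx1 -scalemxAr -scalemxAl scalerA.
  rewrite {4}/ketbra mulmxA ketbraM -scalemxAl -/(ketbra w) scalerA -a_sum.
  have -> : a^-1^* / a * (a + a^*) = a^-1^* + a^-1.
    rewrite fmorphV /=; field; apply/andP; split=> //.
    by rewrite conjC_eq0.
  by rewrite scalerDl opprB addrK subrK.
rewrite mulmxBl mul1mx -scalemxAl ketbraM scalerA.
have -> : braket w u = a by rewrite braketBl u1.
by rewrite mulVf // scale1r /w opprB addrC subrK.
Qed.

(** * Block positivity and completely positive maps *)

Lemma braket_mxcol k d (x y : 'I_k -> 'cV[R[i]]_d) :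
  braket (\mxcol_i x i) (\mxcol_i y i) = \sum_i braket (x i) (y i).
Proof.
rewrite /braket (_ : (\mxcol_i x i) ^t* = \mxrow_i (x i) ^t*).
  by rewrite mul_mxrow_mxcol summxE.
by apply/matrixP => i j; rewrite !mxE.
Qed.

(** Every vector of the block space is a column of [k] blocks, so positivity of an ampliation can be
    tested without block indices. *)
Lemma psd_mxblockP k d (B : 'I_k -> 'I_k -> 'M[R[i]]_d) :
  psd (\mxblock_(i < k, j < k) B i j) <->
  forall x : 'I_k -> 'cV[R[i]]_d,
    0 <= \sum_i \sum_j braket (x i) (B i j *m x j).
Proof.
have E (x : 'I_k -> 'cV[R[i]]_d) :
    braket (\mxcol_i x i) ((\mxblock_(i < k, j < k) B i j) *m \mxcol_i x i) =
    \sum_i \sum_j braket (x i) (B i j *m x j).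
  rewrite mxblockEh mul_mxrow_mxcol braket_sumr [RHS]exchange_big.
  by apply: eq_bigr => j _; rewrite mxcol_mul braket_mxcol.
split=> [Bpsd x|Bpos x]; first by rewrite -E.
by rewrite -(submxcolK x) E.
Qed.

Lemma psd_submxblockP k d (X : 'M[R[i]]_(\sum_(i < k) d)) :
  psd X <-> forall x : 'I_k -> 'cV[R[i]]_d,
    0 <= \sum_i \sum_j braket (x i) (submxblock X i j *m x j).
Proof. by rewrite -psd_mxblockP submxblockK. Qed.

(** This is the ampliation with a single block. *)
Lemma completely_positive_psd d (F : 'M[R[i]]_d -> 'M[R[i]]_d) A :
  completely_positive F -> psd A -> psd (F A).
Proof.
case=> _ Fcp Apsd x.
have /Fcp : psd (\mxblock_(i < 1, j < 1) A).
  by apply/psd_mxblockP => y; rewrite !big_ord1.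
by rewrite /ampliation => /psd_mxblockP/(_ (fun=> x)); rewrite !big_ord1 mxblockK.
Qed.

Lemma linear_exists (V W : lmodType R[i]) (f : V -> W) : linear f ->
  exists g : {linear V -> W}, f =1 g.
Proof.
move=> fl; pose h := GRing.isLinear.Build _ _ _ _ f fl.
by exists (HB.pack_for {linear V -> W} f h).
Qed.

(** Diagonalizing [B] turns the trace into a nonnegative combination of values of the form of
    [A]. *)
Lemma psd_mxtraceM d (A B : 'M[R[i]]_d) :
  psd A -> psd B -> 0 <= \tr (A *m B).
Proof.
move=> Apsd /psd_spectral [b [u [b_ge0 u1 ->]]].
rewrite mulmx_sumr raddf_sum; apply: sumr_ge0 => i _.
rewrite -scalemxAr /= mxtraceZ mxtraceM_ketbra mulr_ge0 //.
by rewrite ler0c.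
Qed.

(* Heisenberg picture: [M'] is the image of [M] under the adjoint of [F]. *)
Lemma dual_effect d (F : 'M[R[i]]_d -> 'M[R[i]]_d) M :
  completely_positive F -> psd M ->
  exists2 M', psd M' & forall rho, \tr (M *m F rho) = \tr (M' *m rho).
Proof.
move=> Fcp Mpsd; have [f fE] := linear_exists Fcp.1.
(* These entries are forced by testing the identity on [rho = delta_mx j i]. *)
pose M' := \matrix_(i, j) \tr (M *m f (delta_mx j i)) : 'M[R[i]]_d.
have M'E rho : \tr (M *m F rho) = \tr (M' *m rho).
  rewrite fE [in LHS](matrix_sum_delta rho) linear_sum mulmx_sumr raddf_sum /=.
  under eq_bigr do rewrite linear_sum mulmx_sumr raddf_sum /=.
  rewrite exchange_big /= /mxtrace; apply: eq_bigr => i _; rewrite [RHS]mxE.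
  apply: eq_bigr => j _; rewrite linearZ -scalemxAr /= [RHS]mulrC -/(\tr _) mxE.
  by rewrite -mxtraceZ.
(* The form of [M'] at [x] pairs [M] with the image under [F] of the projector-like [ketbra x]. *)
exists M' => // x; rewrite -mxtraceM_ketbra -M'E; apply: psd_mxtraceM => //.
exact/(completely_positive_psd Fcp)/psd_ketbra.
Qed.

(** * Admissibility of the discriminate-and-reprepare protocol *)

Lemma linear_dr_instrument d (phi : 'I_d -> 'cV[R[i]]_d) w :
  linear (dr_instrument phi w).
Proof.
by move=> c A B; rewrite /dr_instrument mulmxDr mulmxDl -scalemxAr -scalemxAl.
Qed.

Lemma linear_dr_control d (phi : 'I_d -> 'cV[R[i]]_d) w :
  linear (dr_control phi w).
Proof.
by move=> c A B; rewrite /dr_control mxtraceD mxtraceZ scalerDl scalerA.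
Qed.

(** Conjugation by the Hermitian [ketbra (phi w)] can be moved onto the test vectors. *)
Lemma cp_dr_instrument d (phi : 'I_d -> 'cV[R[i]]_d) w :
  completely_positive (dr_instrument phi w).
Proof.
split=> [|k X /psd_submxblockP Xpsd]; first exact: linear_dr_instrument.
apply/psd_mxblockP => x.
have := Xpsd (fun i => ketbra (phi w) *m x i); congr (0 <= _).
apply: eq_bigr => i _; apply: eq_bigr => j _.
transitivity (braket (x i)
  (ketbra (phi w) *m (submxblock X i j *m (ketbra (phi w) *m x j)))).
  by rewrite [RHS]braket_adjmx psd_hermitian //; exact: psd_ketbra.
by rewrite /dr_instrument !mulmxA.
Qed.

Lemma cp_dr_control d (phi : 'I_d -> 'cV[R[i]]_d) w :
  completely_positive (dr_control phi w).
Proof.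
split=> [|k X /psd_submxblockP Xpsd]; first exact: linear_dr_control.
apply/psd_mxblockP => x.
(* Expanding the trace in the basis [ket a] splits the form into one instance of the positivity of
   [X] per [a]; the overlap with [phi w] is absorbed as a coefficient. *)
pose y a i := braket (phi w) (x i) *: ket a : 'cV[R[i]]_d.
rewrite [X in 0 <= X](_ : _ =
    \sum_a \sum_i \sum_j braket (y a i) (submxblock X i j *m y a j)).
  by apply: sumr_ge0 => a _.
rewrite [RHS]exchange_big; apply: eq_bigr => i _ /=.
rewrite [RHS]exchange_big; apply: eq_bigr => j _ /=.
rewrite /dr_control -scalemxAl braketZr ketbraM braketZr /mxtrace mulr_suml.
apply: eq_bigr => a _; rewrite -scalemxAr braketZr braketZl braket_ket mul_ket.
by rewrite [braket (x i) _]braket_conj; ring.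
Qed.

Section DiscriminateReprepare.
Context (d : nat) (phi : 'I_d -> 'cV[R[i]]_d) (phi_onb : orthonormal_basis phi).

(** The matrix with columns [phi j] has a left inverse, its adjoint; being square, it has the same
    right inverse. *)
Lemma onb_complete : \sum_w ketbra (phi w) = 1%:M.
Proof.
pose P := \matrix_(i, j) phi j i ord0 : 'M[R[i]]_d.
have : P ^t* *m P = 1%:M.
  apply/matrixP => i j; rewrite [RHS]mxE -phi_onb braketE mxE.
  by apply: eq_bigr => k _; rewrite !mxE.
move=> /mulmx1C <-; apply/matrixP => i j; rewrite summxE mxE.
by apply: eq_bigr => k _; rewrite !mxE big_ord1 !mxE.
Qed.

Lemma parseval x : braket x x = \sum_w `|braket (phi w) x| ^+ 2.
Proof.
rewrite -{2}[x]mul1mx -onb_complete mulmx_suml braket_sumr.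
apply: eq_bigr => w _; rewrite ketbraM braketZr [braket x _]braket_conj.
by rewrite -sqr_normc.
Qed.

Lemma mxtrace_dr_instrument w rho :
  \tr (dr_instrument phi w rho) = braket (phi w) (rho *m phi w).
Proof.
rewrite /dr_instrument mxtraceM_ketbra -mulmxA braket_adjmx psd_hermitian.
  by rewrite ketbraM phi_onb eqxx scale1r.
exact: psd_ketbra.
Qed.

Lemma control_protocol_dr :
  control_protocol (dr_instrument phi) (dr_control phi).
Proof.
split=> [w||w]; first exact: cp_dr_instrument.
  split=> [c A B|rho].
    rewrite scaler_sumr -big_split; apply: eq_bigr => w _.
    exact: linear_dr_instrument.
  rewrite raddf_sum -[in RHS](mulmx1 rho) -onb_complete mulmx_sumr raddf_sum.
  apply: eq_bigr => w _; rewrite [LHS]mxtrace_dr_instrument.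
  by rewrite [RHS]mxtraceM_ketbra.
split; last exact: cp_dr_control.
split=> [|rho]; first exact: linear_dr_control.
by rewrite /dr_control mxtraceZ mxtrace_ketbra phi_onb eqxx mulr1.
Qed.
End DiscriminateReprepare.

End Operators.
Arguments ket {R d}.

(** * Moments of the uniform measure on the sphere *)

Section Measurability.
Context (R : realType) (d : nat).
Local Notation Cn := (R[i] : numFieldType).

(** The real part is 1-Lipschitz. The radius is [e%:C] because the norm of [R[i]] takes values in
    [R[i]]. *)
Lemma continuous_Re : continuous (fun z : Cn => complex.Re z : R).
Proof.
move=> z; apply/(@cvgrPdist_lt _ R^o _ _ (nbhs_filter (z : Cn))) => e e0.
exists e%:C; first by rewrite /= ltcR.
move=> w /= zw; rewrite -ltcR; apply: le_lt_trans zw.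
by rewrite -raddfB /= normc_ge_Re.
Qed.

Lemma continuous_measurable_borel_cV (f : 'cV[Cn]_d -> R) :
  continuous f -> measurable_fun setT (f : borel_cV R d -> R).
Proof.
move=> /continuousP cf; apply: (measurability _ (RGenOpens.measurableE R)).
move=> _ [_ [a [b ->] <-]]; rewrite setTI.
by apply: sub_sigma_algebra; exact/cf/interval_open.
Qed.

Lemma measurable_Re_braket (u : 'cV[R[i]]_d) :
  measurable_fun setT (fun psi : borel_cV R d => complex.Re (braket u psi)).
Proof.
have cb : continuous (fun psi : 'cV[Cn]_d => braket u psi : Cn).
  have -> : (fun psi : 'cV[Cn]_d => braket u psi : Cn) =
      (fun psi : 'cV[Cn]_d => \sum_j (u ^t* ord0 j : Cn) * psi j ord0).
    by apply/funext => x; rewrite /braket !mxE.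
  apply: continuous_big => [|j _]; first exact: add_continuous.
  move=> x; apply: (@continuousM _ _ (fun=> (u ^t* ord0 j : Cn))).
    exact: cst_continuous.
  exact: coord_continuous.
apply: continuous_measurable_borel_cV => psi.
by apply: continuous_comp; [exact: cb|exact: continuous_Re].
Qed.
End Measurability.

(** * Squared overlaps with a fixed vector *)

Section Overlap.
Context (R : realType) (d : nat).
Implicit Types u v psi : 'cV[R[i]]_d.

(** The transition probability |<u|psi>|^2, written through real and imaginary parts so that it is a
    real number fit for integration. *)
Definition overlap u psi : R :=
  complex.Re (braket u psi) ^+ 2 + complex.Im (braket u psi) ^+ 2.

Lemma overlapE u psi : (overlap u psi)%:C = `|braket u psi| ^+ 2.
Proof. exact: add_Re2_Im2. Qed.

Lemma overlap_ge0 u psi : 0 <= overlap u psi.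
Proof. by rewrite addr_ge0 // sqr_ge0. Qed.

(** Cauchy-Schwarz: the component of [psi] orthogonal to [u] has nonnegative squared norm. *)
Lemma overlap_le1 u psi :
  braket u u = 1 -> braket psi psi = 1 -> overlap u psi <= 1.
Proof.
move=> u1 psi1; rewrite -lecR overlapE -subr_ge0.
have := braket_ge0 (psi - braket u psi *: u); congr (0 <= _).
rewrite braketBl !braketBr !braketZr !braketZl u1 psi1 sqr_normc.
by rewrite [braket psi u]braket_conj; ring.
Qed.

Lemma sum_overlap (phi : 'I_d -> 'cV[R[i]]_d) psi : orthonormal_basis phi ->
  (\sum_w overlap (phi w) psi)%:C = braket psi psi.
Proof.
move=> phi_onb; rewrite (parseval phi_onb) raddf_sum.
by apply: eq_bigr => w _; rewrite /= overlapE.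
Qed.

Lemma orthonormal_ket : orthonormal_basis (@ket R d).
Proof. by move=> i j; rewrite braket_ket mxE eqxx andbT. Qed.

Lemma overlap_unitary (U : 'M[R[i]]_d) u psi : U \is unitarymx ->
  overlap (U *m u) (U *m psi) = overlap u psi.
Proof.
rewrite -trmxC_unitary => /unitarymxP; rewrite trmxCK => UU.
by rewrite /overlap braket_adjmx mulmxA UU mul1mx.
Qed.

Lemma measurable_overlap u :
  measurable_fun setT (fun psi : borel_cV R d => overlap u psi).
Proof.
apply: measurable_funD; apply: measurable_funX; first exact: measurable_Re_braket.
(* The imaginary part of <u|psi> is the real part of <iu|psi>, as the bracket is conjugate-linear on
   the left. *)
rewrite (_ : (fun _ => _) =
    fun psi : borel_cV R d => complex.Re (braket ('i%C *: u) psi)).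
  exact: measurable_Re_braket.
apply/funext => psi; rewrite braketZl.
by case: (braket u psi) => a b; rewrite /=; ring.
Qed.

Lemma measurable_unit_sphere : measurable (@unit_sphere R d).
Proof.
rewrite (_ : unit_sphere (d:=d) =
    setT `&`
      (fun psi : borel_cV R d => \sum_i overlap (ket i) psi) @^-1` [set 1]).
  apply: measurable_sum => // i; exact: measurable_overlap.
rewrite setTI; apply/seteqP; split=> psi;
    rewrite /unit_sphere /= -(sum_overlap _ orthonormal_ket).
  exact: (@complexI R _ 1).
by move=> ->.
Qed.
End Overlap.
Arguments overlap_ge0 {R d}.

(** Both conclusions are proved in one induction, since additivity of the integral needs
    integrability of the tail. *)
Lemma Rintegral_sum (dT : measure_display) (T : measurableType dT)
    (R : realType) (mu : {measure set T -> \bar R}) (D : set T)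
    (I : Type) (r : seq I) (f : I -> T -> R) : measurable D ->
  (forall i, mu.-integrable D (EFin \o f i)) ->
  mu.-integrable D (EFin \o (fun x => \sum_(i <- r) f i x)) /\
  \int[mu]_(x in D) \sum_(i <- r) f i x =
    \sum_(i <- r) \int[mu]_(x in D) f i x.
Proof.
move=> mD fi; elim: r => [|i r [intr IH]].
  have E : (fun x : T => \sum_(i <- [::]) f i x) = cst 0.
    by apply/funext => x; rewrite big_nil.
  by rewrite E big_nil Rintegral_cst // mul0r; split=> //; exact: integrable0.
have E : (fun x => \sum_(j <- i :: r) f j x) =
    fun x => f i x + \sum_(j <- r) f j x.
  by apply/funext => x; rewrite big_cons.
rewrite E big_cons RintegralD // IH; split=> //.
exact: (integrableD mD (fi i) intr).
Qed.

(* Locked, because comparing two such integrals up to conversion diverges. *)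
HB.lock Definition overlap_corr (R : realType) (d : nat)
    (mu : probability (borel_cV R d) R) (u v : 'cV[R[i]]_d) : R :=
  \int[mu]_(psi in @unit_sphere R d) (overlap u psi * overlap v psi).

(** * Fourth moments of the uniform measure *)

Section OverlapIntegrals.
Context (R : realType) (d : nat) (mu : probability (borel_cV R d) R).
Implicit Types u v psi : 'cV[R[i]]_d.
Local Notation S := (@unit_sphere R d).
Let mS : measurable S := @measurable_unit_sphere R d.

Lemma integrable_overlapM u v : braket u u = 1 -> braket v v = 1 ->
  mu.-integrable S (EFin \o (fun psi => overlap u psi * overlap v psi)).
Proof.
move=> u1 v1; apply: measurable_bounded_integrable => //.
- by rewrite (le_lt_trans (probability_le1 mu mS)) ?ltry.
- by apply/measurable_funTS/measurable_funM; exact: measurable_overlap.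
exists 1; split; first exact: num_real.
move=> M M1 psi psi1; apply: le_trans (ltW M1).
rewrite /= ger0_norm ?mulr_ge0 ?overlap_ge0 //.
by rewrite mulr_ile1 ?overlap_ge0 ?overlap_le1.
Qed.

(** Turns pointwise polynomial identities between overlaps into linear relations between the
    [overlap_corr]. *)
Lemma Rintegral_overlapM_sum (I : Type) (r : seq I) (c : I -> R)
    (u v : I -> 'cV[R[i]]_d) :
  (forall i, braket (u i) (u i) = 1) -> (forall i, braket (v i) (v i) = 1) ->
  mu.-integrable S (EFin \o
    (fun psi => \sum_(i <- r) c i * (overlap (u i) psi * overlap (v i) psi))) /\
  \int[mu]_(psi in S)
      \sum_(i <- r) c i * (overlap (u i) psi * overlap (v i) psi) =
    \sum_(i <- r) c i * overlap_corr mu (u i) (v i).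
Proof.
move=> u1 v1; have iM i := integrable_overlapM (u1 i) (v1 i).
have [] := @Rintegral_sum _ _ _ mu S _ r
  (fun i psi => c i * (overlap (u i) psi * overlap (v i) psi)) mS.
  by move=> i; exact: (integrableZl mS (c i) (iM i)).
move=> intr E; split=> //; apply: (etrans E); apply: eq_bigr => i _.
by rewrite overlap_corr.unlock; exact: (RintegralZl _ mS (iM i)).
Qed.

Lemma overlap_corr_const u v : uniform_on_sphere mu ->
  braket u u = 1 -> braket v v = 1 ->
  overlap_corr mu u u = overlap_corr mu v v.
Proof.
move=> mu_unif u1 v1; have [U UU Uu] := unitary_transport u1 v1.
(* The integral is a second moment of the law of [overlap w] on the real line, so it suffices that
   [u] and [v] give the same law. *)
have E w : overlap_corr mu w w =
    fine (\int[pushforward mu (overlap w : borel_cV R d -> R)]_x (x * x)%:E)%E.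
  rewrite ge0_integral_pushforward //.
  - rewrite preimage_setT overlap_corr.unlock /Rintegral.
    (* The complement of the sphere is negligible, so integrating over the whole space changes
       nothing. *)
    rewrite [in RHS](@ge0_negligible_integral _ _ _ _ _ (~` S)) //.
    + by rewrite setTD setCK.
    + exact: measurableC.
    + apply/measurable_EFinP/measurable_funM; exact: measurable_overlap.
    + by move=> x _; rewrite lee_fin mulr_ge0 ?overlap_ge0.
    + rewrite (_ : _ (~` S) = 1 - mu S)%E; first by rewrite mu_unif.1 subee.
      exact: probability_setC.
  - exact: measurable_overlap.
  - by apply/measurable_EFinP/measurable_funM; exact: measurable_id.
  - by move=> x _; rewrite lee_fin -expr2 sqr_ge0.
rewrite (E u) (E v); apply: (congr1 fine).
apply: eq_measure_integral => [||? ? A mA _]; [exact: measurable_overlap..|].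
change (mu (overlap u @^-1` A) = mu (overlap v @^-1` A)).
rewrite -[RHS](mu_unif.2 _ UU); last first.
  by rewrite -[X in measurable X]setTI; exact: measurable_overlap.
by congr (mu _); apply/seteqP; split=> psi /=; rewrite -Uu overlap_unitary.
Qed.

Context (mu_unif : uniform_on_sphere mu).

Lemma overlap_corr_le u v : braket u u = 1 -> braket v v = 1 ->
  overlap_corr mu u v <= overlap_corr mu u u.
Proof.
move=> u1 v1; pose w (b : bool) := if b then u else v.
have w1 b : braket (w b) (w b) = 1 by case: b.
(* The coefficients 1, -2, 1 are those of the square of [overlap u psi - overlap v psi]. *)
have [_] := Rintegral_overlapM_sum
  [:: (true, true); (true, false); (false, false)]
  (fun p => if p.1 == p.2 then 1 else -2) (fun p => w1 p.1) (fun p => w1 p.2).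
rewrite !big_cons big_nil /= (overlap_corr_const mu_unif v1 u1) => E.
suff : 0 <= 1 * overlap_corr mu u u +
    (-2 * overlap_corr mu u v + (1 * overlap_corr mu u u + 0)) by lra.
rewrite -E; apply: Rintegral_ge0 => psi _; rewrite !big_cons big_nil /=.
rewrite [X in 0 <= X](_ : _ = (overlap u psi - overlap v psi) ^+ 2) ?sqr_ge0 //.
by ring.
Qed.

(* Weights 3/5 and 4/5 give unit vectors without square roots; the fourth roots of
   unity cancel the phase-dependent terms of [|<omega_vec|psi>|^4]. *)
Definition omega_vec (i j : 'I_d) (k : 'I_4) : 'cV[R[i]]_d :=
  (3 / 5) *: ket i + ('i%C ^+ k * (4 / 5)) *: ket j.

Lemma omega_vec_unit i j k : i != j ->
  braket (omega_vec i j k) (omega_vec i j k) = 1.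
Proof.
move=> /negbTE ij; rewrite /omega_vec braketDl !braketDr !braketZl !braketZr.
rewrite !orthonormal_ket !eqxx ij eq_sym ij.
have ik : ('i%C ^+ k : R[i])^* * 'i%C ^+ k = 1.
  by rewrite rmorphXn -exprMn /= (_ : _ * _ = 1) ?expr1n //; simpc.
rewrite !rmorphM fmorphV /= !rmorph_nat.
rewrite !mulr0 addr0 add0r !mulr1.
move: ik; move: ('i%C ^+ k) => z ik.
transitivity (9 / 25 + (z^* * z) * (16 / 25) : R[i]); first by field.
by rewrite ik; field.
Qed.

(** 81 and 256 are 3^4 and 4^4. Of 576 = 4 * 9 * 16, half is the product of the two intensities and
    half the mean square of the interference term, whose odd powers cancel over the four phases. *)
Lemma sum_overlap_omega_vec i j psi :
  \sum_(k < 4) overlap (omega_vec i j k) psi * overlap (omega_vec i j k) psi =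
  4 / 625 * (81 * (overlap (ket i) psi * overlap (ket i) psi)
           + 256 * (overlap (ket j) psi * overlap (ket j) psi)
           + 576 * (overlap (ket i) psi * overlap (ket j) psi)).
Proof.
have E k : braket (omega_vec i j k) psi =
    (3 / 5 : R)%:C * braket (ket i) psi
    + (('i%C ^+ k)^* * (4 / 5 : R)%:C) * braket (ket j) psi.
  rewrite braketDl !braketZl !rmorphM !fmorphV /= !rmorph_nat.
  by congr (_ * _ + _ * _ * _).
case Ex: (braket (ket i) psi) => [x1 x2].
case Ey: (braket (ket j) psi) => [y1 y2].
have O (k : 'I_4) c s : ('i%C ^+ k)^* = c +i* s -> overlap (omega_vec i j k) psi =
    (3 / 5 * x1 + 4 / 5 * (c * y1 - s * y2)) ^+ 2
    + (3 / 5 * x2 + 4 / 5 * (c * y2 + s * y1)) ^+ 2.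
  by move=> ck; rewrite /overlap E [X in _ + X * _ * _]ck Ex Ey /=;
    congr (_ ^+ 2 + _ ^+ 2); field.
(* Real and imaginary parts of the conjugates of 1, i, -1, -i. *)
pose cs : seq (R * R) := [:: (1, 0); (0, -1); (-1, 0); (0, 1)].
have csE (k : 'I_4) : ('i%C ^+ k)^* = (cs`_k).1 +i* (cs`_k).2.
  by case: k => -[|[|[|[|k]]]] //= _; simpc.
under eq_bigr => k _ do rewrite (O k _ _ (csE k)).
rewrite !big_ord_recr big_ord0 /= /overlap Ex Ey /=.
by field.
Qed.

(** With J the common diagonal value and K the mixed one, integrating the four-phase identity gives
    625 J = (81 + 256) J + 576 K. *)
Lemma overlap_corr_ket i j : i != j ->
  overlap_corr mu (ket i) (ket j) = overlap_corr mu (ket i) (ket i) / 2.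
Proof.
move=> ij; pose w (b : bool) : 'cV[R[i]]_d := if b then ket i else ket j.
have w1 b : braket (w b) (w b) = 1 by case: b; rewrite orthonormal_ket eqxx.
have [_ E3] := Rintegral_overlapM_sum
  [:: (true, true); (false, false); (true, false)]
  (fun p => 4 / 625 * (if p.1 then if p.2 then 81 else 576 else 256))
  (fun p => w1 p.1) (fun p => w1 p.2).
have [_ E4] := Rintegral_overlapM_sum (index_enum 'I_4) (fun=> 1)
  (fun k => omega_vec_unit k ij) (fun k => omega_vec_unit k ij).
have E : \int[mu]_(psi in S) \sum_(k < 4) 1 *
      (overlap (omega_vec i j k) psi * overlap (omega_vec i j k) psi) =
    \int[mu]_(psi in S)
      \sum_(p <- [:: (true, true); (false, false); (true, false)])
      4 / 625 * (if p.1 then if p.2 then 81 else 576 else 256) *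
      (overlap (w p.1) psi * overlap (w p.2) psi).
  apply: eq_Rintegral => psi _; under eq_bigr do rewrite mul1r.
  by rewrite sum_overlap_omega_vec !big_cons big_nil /=; ring.
have := etrans (etrans (esym E4) E) E3.
under eq_bigr => k _ do
  rewrite mul1r (overlap_corr_const mu_unif (omega_vec_unit k ij) (w1 true)).
rewrite sumr_const card_ord !big_cons big_nil /= -mulr_natr.
rewrite (overlap_corr_const mu_unif (w1 false) (w1 true)) /=.
by move=> ?; lra.
Qed.

Lemma overlap_corr_diag u : braket u u = 1 ->
  overlap_corr mu u u = 2 / (d%:R * (d%:R + 1)).
Proof.
move=> u1.
have ket1 i : braket (@ket R d i) (ket i) = 1 by rewrite orthonormal_ket eqxx.
have [_] := Rintegral_overlapM_sum (index_enum ('I_d * 'I_d)%type)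
  (fun=> 1) (fun p => ket1 p.1) (fun p => ket1 p.2).
rewrite (@eq_Rintegral _ _ _ mu S (cst 1)); last first.
  move=> psi; rewrite inE => psi1 /=.
  rewrite -(pair_bigA _
    (fun i j => 1 * (overlap (ket i) psi * overlap (ket j) psi))) /=.
  under eq_bigr => i _ do under eq_bigr do rewrite mul1r.
  under eq_bigr do rewrite -mulr_sumr.
  rewrite -mulr_suml.
  have -> : \sum_i overlap (ket i) psi = 1.
    by apply: complexI; rewrite (sum_overlap _ (@orthonormal_ket R d)) psi1.
  by rewrite mulr1.
rewrite Rintegral_cst // [fine _](congr1 fine mu_unif.1) mulr1.
rewrite -(pair_bigA _ (fun i j => 1 * overlap_corr mu (ket i) (ket j))) /=.
(* One diagonal term J and [d.-1] terms J / 2. *)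
have E i : \sum_j 1 * overlap_corr mu (ket i) (ket j) =
    overlap_corr mu u u * ((d%:R + 1) / 2).
  rewrite (bigD1 i) //= mul1r.
  under eq_bigr => j ji do rewrite mul1r overlap_corr_ket 1?eq_sym //.
  rewrite sumr_const (overlap_corr_const mu_unif (ket1 i) u1).
  rewrite (_ : #|_| = d.-1); last first.
    by have := cardC1 i; rewrite card_ord.
  (* The index [i] witnesses that [d] is positive, so [d.-1] does not truncate. *)
  have d0 : (0 < d)%N by case: (i) => m /=; case: (d).
  have -> : d%:R = d.-1%:R + 1 :> R by rewrite natr1 prednK.
  by rewrite -mulr_natr; field.
under eq_bigr do rewrite E.
rewrite sumr_const card_ord -[_ * _ *+ d]mulr_natr => J1.
(* In dimension 0 the relation [J1] would read 1 = 0. *)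
have d0 : d%:R != 0 :> R.
  by apply/eqP => d0; have := @ltr01 R; rewrite [X in _ < X]J1 d0 mulr0 ltxx.
have d1 : d%:R + 1 != 0 :> R by rewrite natr1 pnatr_eq0.
transitivity (overlap_corr mu u u * ((d%:R + 1) / 2) * d%:R
  * (2 / (d%:R * (d%:R + 1)))); first by field; rewrite d1 d0.
by rewrite -J1 mul1r.
Qed.
End OverlapIntegrals.

(** * Fidelity under QCQ noise *)

Section Fidelity.
Context (R : realType) (d : nat).

Lemma psd_overlap (A : 'M[R[i]]_d) : psd A ->
  exists (a : 'I_d -> R) (u : 'I_d -> 'cV[R[i]]_d),
    [/\ forall i, 0 <= a i, forall i, braket (u i) (u i) = 1,
        \tr A = (\sum_i a i)%:C
      & forall psi, braket psi (A *m psi) = (\sum_i a i * overlap (u i) psi)%:C].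
Proof.
move=> /psd_spectral[a [u [a_ge0 u1 ->]]]; exists a, u; split=> // [|psi].
  rewrite !raddf_sum; apply: eq_bigr => i _.
  by rewrite /= mxtraceZ mxtrace_ketbra u1 mulr1.
rewrite mulmx_suml braket_sumr raddf_sum; apply: eq_bigr => i _.
rewrite -scalemxAl ketbraM !braketZr [braket psi _]braket_conj -sqr_normc.
by rewrite -overlapE -rmorphM.
Qed.

Context (mu : probability (borel_cV R d) R).
Context (mu_unif : uniform_on_sphere mu).
Local Notation S := (@unit_sphere R d).

(** After diagonalizing both operators, every correlation is at most the diagonal value, and the
    products of the weights add up to the product of the traces. *)
Lemma Rintegral_psdM (A B : 'M[R[i]]_d) : psd A -> psd B ->
  mu.-integrable S (EFin \o (fun psi =>
    complex.Re (braket psi (A *m psi) * braket psi (B *m psi)))) /\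
  \int[mu]_(psi in S) complex.Re (braket psi (A *m psi) * braket psi (B *m psi))
    <= 2 / (d%:R * (d%:R + 1)) * complex.Re (\tr A * \tr B).
Proof.
move=> /psd_overlap[a [u [a_ge0 u1 -> aE]]] /psd_overlap[b [v [b_ge0 v1 -> bE]]].
have [iAB EAB] := Rintegral_overlapM_sum mu (index_enum ('I_d * 'I_d)%type)
  (fun p => a p.1 * b p.2) (fun p => u1 p.1) (fun p => v1 p.2).
have E : (fun psi => complex.Re (braket psi (A *m psi) * braket psi (B *m psi))) =
    (fun psi => \sum_p a p.1 * b p.2 *
      (overlap (u p.1) psi * overlap (v p.2) psi)).
  apply/funext => psi; rewrite aE bE -rmorphM /= big_distrlr pair_bigA /=.
  by apply: eq_bigr => p _; rewrite mulrACA.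
rewrite E; split=> //; rewrite EAB -rmorphM /= big_distrlr pair_bigA /= mulr_sumr.
apply: ler_sum => p _; rewrite mulrC ler_wpM2r ?mulr_ge0 //.
by rewrite -(overlap_corr_diag mu_unif (u1 p.1)) overlap_corr_le.
Qed.

(** The effects sum to the identity and the states have trace one; through this the noise enters the
    fidelity of discriminate and reprepare. *)
Lemma qcq_mxtrace (N : 'M[R[i]]_d -> 'M[R[i]]_d) rho :
  qcq N -> \tr (N rho) = \tr rho.
Proof.
case=> n [sigma [M [sigmaD [_ M1] ->]]].
rewrite -[in RHS](mul1mx rho) -M1 mulmx_suml !raddf_sum; apply: eq_bigr => k _.
by rewrite /= mxtraceZ (sigmaD k).2 mulr1.
Qed.

Lemma average_fidelity_qcq_le (N : 'M[R[i]]_d -> 'M[R[i]]_d) (Omega : finType)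
    (I C : Omega -> 'M[R[i]]_d -> 'M[R[i]]_d) :
  qcq N -> control_protocol I C -> d%:R != 0 :> R ->
  average_fidelity mu N I C <= 2 / (d%:R + 1).
Proof.
move=> [n [sigma [M [sigmaD [Mpsd M1] NE]]]] [Icp Itp Ctpcp] d0.
(* The joint outcome of instrument and noise has as its effect [M p.2] pulled back through
   [I p.1]. *)
have /choice[E EP] (p : Omega * 'I_n) : exists E, psd E /\
    forall rho, \tr (M p.2 *m I p.1 rho) = \tr (E *m rho).
  by have [E ? ?] := dual_effect (Icp p.1) (Mpsd p.2); exists E.
have opE rho : average_operation N I C rho =
    \sum_p \tr (E p *m rho) *: C p.1 (sigma p.2).
  transitivity (\sum_w \sum_k \tr (E (w, k) *m rho) *: C w (sigma k)); last first.
    by rewrite pair_bigA; apply: eq_bigr => -[].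
  apply: eq_bigr => w _; have [c cE] := linear_exists (Ctpcp w).1.1.
  rewrite NE cE linear_sum; apply: eq_bigr => k _.
  by rewrite linearZ /= -cE -(EP (w, k)).2.
have Cpsd w k : psd (C w (sigma k)).
  exact: completely_positive_psd (Ctpcp w).2 (sigmaD k).1.
have Ctr w k : \tr (C w (sigma k)) = 1.
  by rewrite (Ctpcp w).1.2 (sigmaD k).2.
(* Evaluate the effects at the identity: the POVM sums out over [k], and trace preservation of the
   total instrument leaves the trace of [1%:M]. *)
have Etr : \sum_p \tr (E p) = (d%:R)%:C.
  rewrite rmorph_nat.
  under eq_bigr do rewrite -[E _]mulmx1 -(EP _).2.
  rewrite -(pair_bigA _ (fun w k => \tr (M k *m I w 1%:M))) /=.
  rewrite -(mxtrace1 _ d) -Itp.2 raddf_sum; apply: eq_bigr => w _.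
  by rewrite -raddf_sum -mulmx_suml M1 mul1mx.
have integrandE psi :
    complex.Re (braket psi (average_operation N I C (ketbra psi) *m psi)) =
    \sum_p complex.Re (braket psi (E p *m psi) *
      braket psi (C p.1 (sigma p.2) *m psi)).
  rewrite opE mulmx_suml braket_sumr raddf_sum; apply: eq_bigr => p _.
  by rewrite -scalemxAl braketZr mxtraceM_ketbra.
rewrite /average_fidelity; under eq_Rintegral do rewrite integrandE.
have int p := Rintegral_psdM (EP p).1 (Cpsd p.1 p.2).
have [_ ->] := Rintegral_sum (index_enum (Omega * 'I_n)%type)
  (@measurable_unit_sphere R d) (fun p => (int p).1).
apply: le_trans (ler_sum _ (fun p _ => (int p).2)) _.
under eq_bigr do rewrite Ctr mulr1.
rewrite -mulr_sumr -raddf_sum Etr.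
rewrite /= le_eqVlt; apply/orP; left; apply/eqP; field.
by rewrite d0 natr1 pnatr_eq0.
Qed.

Lemma average_fidelity_dr (N : 'M[R[i]]_d -> 'M[R[i]]_d)
    (phi : 'I_d -> 'cV[R[i]]_d) :
  qcq N -> orthonormal_basis phi -> d%:R != 0 :> R ->
  average_fidelity mu N (dr_instrument phi) (dr_control phi) = 2 / (d%:R + 1).
Proof.
move=> Nqcq phi_onb d0.
have phi1 w : braket (phi w) (phi w) = 1 by rewrite phi_onb eqxx.
have integrandE psi : complex.Re (braket psi (average_operation N
      (dr_instrument phi) (dr_control phi) (ketbra psi) *m psi)) =
    \sum_w 1 * (overlap (phi w) psi * overlap (phi w) psi).
  (* [dr_control] keeps only the trace of the noisy state, which is the probability of outcome [w];
     repreparing contributes a second factor [overlap (phi w) psi]. *)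
  rewrite mulmx_suml braket_sumr raddf_sum; apply: eq_bigr => w _.
  rewrite /dr_control (qcq_mxtrace _ Nqcq) (mxtrace_dr_instrument phi_onb).
  rewrite ketbraM -scalemxAl ketbraM !braketZr.
  rewrite [braket psi (phi w)]braket_conj [_^*%C * _]mulrC.
  by rewrite -sqr_normc -overlapE -rmorphM mul1r.
rewrite /average_fidelity; under eq_Rintegral do rewrite integrandE.
have [_ ->] := Rintegral_overlapM_sum mu (index_enum 'I_d) (fun=> 1) phi1 phi1.
under eq_bigr do rewrite mul1r (overlap_corr_diag mu_unif (phi1 _)).
rewrite sumr_const card_ord -[_ / _ *+ d]mulr_natr; field.
by rewrite d0 natr1 pnatr_eq0.
Qed.

(** In dimension 0 the sphere is empty, so it cannot carry mass one. *)
Lemma uniform_dim_neq0 : d%:R != 0 :> R.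
Proof.
rewrite pnatr_eq0; apply/eqP => d0; have := mu_unif.1.
rewrite (_ : S = set0) ?measure0 => [/eqP|]; first by rewrite eq_sym onee_eq0.
apply/seteqP; split=> // psi; rewrite /unit_sphere /= braketE big1 => [/eqP|j _].
  by rewrite eq_sym oner_eq0.
by have := ltn_ord j; rewrite [in X in (_ < X)%N]d0.
Qed.
End Fidelity.

Theorem proposition2 (R : realType) (d : nat)
    (mu : probability (borel_cV R d) R) (mu_unif : uniform_on_sphere mu)
    (N : 'M[R[i]]_d -> 'M[R[i]]_d) (N_qcq : qcq N)
    (phi : 'I_d -> 'cV[R[i]]_d) (phi_onb : orthonormal_basis phi) :
  optimal_protocol mu N (dr_instrument phi) (dr_control phi) /\
  average_fidelity mu N (dr_instrument phi) (dr_control phi) = 2 / (d%:R + 1).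
Proof.
have d0 := uniform_dim_neq0 mu_unif.
have drE := average_fidelity_dr mu_unif N_qcq phi_onb d0.
split; last exact: drE.
split=> [|Omega I C IC]; first exact: control_protocol_dr.
apply: le_trans (average_fidelity_qcq_le mu_unif N_qcq IC d0) _.
by rewrite drE.
Qed.
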